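(* Let $A$ be a finite set of items, $\mathcal{F}$ an antimonotonic family of itemsets over $A$, and $B\subseteq A$. Run the Algorithm (described in the context) on input $B$ and $\mathcal{F}$. Let $C$ be the current set at the start of some iteration of the outer loop in which a violation is found, and let $Z$ be the set of items added to $C$ in that iteration. Then for every safe set $Y$ with $C\subseteq Y$ we have $Z\subseteq Y$.
   Context: An itemset is a subset of $A=\{a_1,\dots,a_K\}$; $S_U(z)=1$ iff $z_i=1$ for all $a_i\in U$. $\mathcal{F}$ is antimonotonic if closed under subsets. A distribution $p$ on $\{0,1\}^K$ satisfies $\theta=(\theta_U)_{U\in\mathcal{F}}$ if $E_p[S_U]=\theta_U$ for all $U\in\mathcal{F}$; ''frequencies for $\mathcal{F}$'' are such $\theta$ satisfied by some distribution. For $C\subseteq A$, $\pi_C\theta=(\theta_U)_{U\in\mathcal{F},U\subseteq C}$ and $\pi_Cp$ is the marginal of $p$ on the coordinates in $C$. $C$ is safe if for all frequencies $\theta$ for $\mathcal{F}$, every distribution $q$ on $\{0,1\}^C$ with $E_q[S_U]=\theta_U$ for all $U\in\mathcal{F}$, $U\subseteq C$, has an extension $p$ on $\{0,1\}^K$ (i.e. $\pi_Cp=q$) satisfying $\theta$. The dependency graph $G$ has vertex set $A$ and edges $\{a_i,a_j\}$ ($i\ne j$) with $\{a_i,a_j\}\in\mathcal{F}$. For $x\notin C$ and $r\ge 0$, the restricted neighbourhood $N(x,r;C)$ is the set of items $y$ reachable from $x$ by a path in $G$ of length (number of edges) at most $r$ in which only the last vertex may belong to $C$. The rank of $x$ w.r.t.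 $C$ is the vector $\mathrm{rank}(x,C)\in\mathbb{Z}^{|A|-1}$ with $i$-th entry $|C\cap(N(x,i;C)\setminus N(x,i-1;C))|$; ranks are compared lexicographically. The Algorithm: set $C:=B$. Repeat the following outer loop: set $r:=1$ and $V:=\{x\notin C: x \text{ is adjacent in } G \text{ to some } y\in C\}$; then repeat: for each $x\in V$ set $U_x:=N(x,r;C)\cap C$; if some $U_x\notin\mathcal{F}$, stop this inner loop (a violation is found); otherwise $r:=r+1$; the inner loop also stops when no $U_x$ changed. If a violation was found, let $W:=\{x\in V:U_x\notin\mathcal{F}\}$, $v:=\max\{\mathrm{rank}(x,C):x\in W\}$, $Z:=\{x\in W:\mathrm{rank}(x,C)=v\}$, and set $C:=C\cup Z$. The outer loop terminates when no violation is found, and the final $C$ is output. *)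

(* Defs.v *)
From HB Require Import structures.
From mathcomp Require Import all_boot all_order all_algebra.
From mathcomp Require Import reals.

Set Implicit Arguments.
Unset Strict Implicit.
Unset Printing Implicit Defensive.

Import Order.TTheory GRing.Theory Num.Theory.

Local Open Scope ring_scope.

Section Distributions.
Variable R : realType.

(* A point of {0,1}^I is a finite function z : {ffun I -> bool}. *)
Definition is_distr (I : finType) (p : {ffun {ffun I -> bool} -> R}) : Prop :=
  (forall z, 0 <= p z) /\ \sum_z p z = 1.

Definition expectation (I : finType) (p : {ffun {ffun I -> bool} -> R})
    (f : {ffun I -> bool} -> R) : R :=
  \sum_z p z * f z.

Definition Sfun (I : finType) (U : {set I}) (z : {ffun I -> bool}) : R :=
  [forall i in U, z i]%:R.

Variable A : finType.

(* theta is a total function on itemsets; only its values on F matter. *)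
Definition satisfies (F : {set {set A}}) (theta : {set A} -> R)
    (p : {ffun {ffun A -> bool} -> R}) : Prop :=
  forall U : {set A}, U \in F -> expectation p (Sfun U) = theta U.

Definition frequencies (F : {set {set A}}) (theta : {set A} -> R) : Prop :=
  exists2 p : {ffun {ffun A -> bool} -> R}, is_distr p & satisfies F theta p.

Definition items (C : {set A}) : finType := {x : A | x \in C}.

Definition restrict (C : {set A}) (z : {ffun A -> bool}) :
    {ffun items C -> bool} :=
  [ffun i => z (val i)].

Definition marginal (C : {set A}) (p : {ffun {ffun A -> bool} -> R}) :
    {ffun {ffun items C -> bool} -> R} :=
  [ffun w => \sum_(z | restrict C z == w) p z].

(* For U \subset C, the set val @^-1: U is U viewed as a set of items of C. *)
Definition satisfies_in (F : {set {set A}}) (C : {set A})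
    (theta : {set A} -> R) (q : {ffun {ffun items C -> bool} -> R}) : Prop :=
  forall U : {set A}, U \in F -> U \subset C ->
    expectation q (Sfun (val @^-1: U)) = theta U.

Definition safe (F : {set {set A}}) (C : {set A}) : Prop :=
  forall theta : {set A} -> R, frequencies F theta ->
  forall q : {ffun {ffun items C -> bool} -> R},
    is_distr q -> satisfies_in F theta q ->
    exists p : {ffun {ffun A -> bool} -> R},
      [/\ is_distr p, marginal C p = q & satisfies F theta p].

End Distributions.

Section Algorithm.
Variables (A : finType) (F : {set {set A}}).

Definition antimonotonic : Prop :=
  forall U V : {set A}, V \in F -> U \subset V -> U \in F.

Definition adj : rel A := fun x y => (x != y) && ([set x; y] \in F).

(* The path is x :: s; it has size s edges, last vertex last x s, and
   belast x s lists its other vertices. *)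
Definition nbhd (x : A) (r : nat) (C : {set A}) : {set A} :=
  [set y | [exists k : 'I_r.+1, [exists s : k.-tuple A,
    [&& path adj x s, uniq (x :: s), last x s == y
      & all (fun u => u \notin C) (belast x s)]]]].

(* The entries are cardinals, so they are taken in nat. The i-th entry in
   1-based numbering is the component of index i - 1 here. *)
Definition rank (x : A) (C : {set A}) : (#|A|.-1).-tuplelexi nat :=
  [tuple #|C :&: (nbhd x i.+1 C :\: nbhd x i C)| | i < #|A|.-1].

Definition boundary (C : {set A}) : {set A} :=
  [set x | (x \notin C) && [exists y in C, adj x y]].

(* The value of U_x after the pass of the inner loop at radius r. *)
Definition reach (C : {set A}) (r : nat) (x : A) : {set A} :=
  nbhd x r C :&: C.

Definition violators (C : {set A}) (r : nat) : {set A} :=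
  [set x in boundary C | reach C r x \notin F].

(* Some U_x changed in the pass at radius r. At radius 1 this compares with
   reach C 0 x, which is empty for x outside C, whereas reach C 1 x is nonempty
   for x in the boundary: the first assignment of the U_x counts as a change,
   unless the boundary is empty, in which case there is never a violation. *)
Definition changed (C : {set A}) (r : nat) : bool :=
  [exists x in boundary C, reach C r x != reach C r.-1 x].

(* inner C r: with current set C, the inner loop executes the pass at r. *)
Inductive inner (C : {set A}) : nat -> Prop :=
| inner_start : inner C 1
| inner_next r : inner C r -> violators C r = set0 -> changed C r ->
    inner C r.+1.

(* With current set C, the inner loop stops at radius r on a violation. *)
Definition violation_found (C : {set A}) (r : nat) : Prop :=
  inner C r /\ violators C r != set0.

(* The maximum is over a nonempty set whenever a violation is found; the
   default value of the iterated maximum is the zero vector. *)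
Definition added (C : {set A}) (r : nat) : {set A} :=
  let v := \big[Order.max/Order.bottom]_(x in violators C r) rank x C in
  [set x in violators C r | rank x C == v].

(* outer B C: on input B, C is the current set at the start of some iteration
   of the outer loop. *)
Inductive outer (B : {set A}) : {set A} -> Prop :=
| outer_start : outer B B
| outer_next C r : outer B C -> violation_found C r ->
    outer B (C :|: added C r).

End Algorithm.

(* Main.v *)
Require Import Defs.
From mathcomp Require Import all_boot all_order all_algebra.
From mathcomp Require Import reals.

(* The items of Y reachable from x \notin Y through items outside Y form a set
   W. Safety of Y forces W to be in F, so W is a clique of the dependency graph.
   If C \subset Y and x is in Z but not in Y, then U_x is not contained in W, so
   a shortest path from x to some item of U_x :\: W first enters Y at an item y
   of W :\: C. As y is adjacent to all the other items of W, it is at most as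
   far from each item of C as x is, and strictly closer to one of them: y is a
   violator whose rank exceeds the rank of x, which was maximal. Radius #|A| - 1
   stands for unbounded paths, since simple paths suffice. *)

Set Implicit Arguments.
Unset Strict Implicit.
Unset Printing Implicit Defensive.

Import Order.TTheory GRing.Theory Num.Theory.

Local Open Scope ring_scope.

(** * Restricted neighbourhoods and ranks: the combinatorial half *)

Section Neighbourhoods.
Variables (A : finType) (F : {set {set A}}).
Implicit Types (x y c h u : A) (r : nat) (s : seq A).
Implicit Types (C Y : {set A}).

(** Loop erasure preserves both ends, and in a simple path the last vertex, which may lie in [C], is
    not among the earlier ones. *)
Lemma nbhd_size x C s :
    path (adj F) x s -> all (fun u => u \notin C) (belast x s) ->
  exists2 r, (r <= size s)%N && (r < #|A|)%N & last x s \in nbhd F x r C.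
Proof.
move=> ps alls; have [l lE] : exists l, l = last x s by exists (last x s).
case: (shortenP ps) (lE) => s' ps' us' subs' l'E.
have uc : uniq (rcons (belast x s') (last x s')) by rewrite -lastI.
exists (size s').
  rewrite uniq_leq_size //=; last by case/andP: us'.
  by rewrite -[(size s').+1]/(size (x :: s')) -(card_uniqP us') max_card.
rewrite inE; apply/existsP; exists ord_max; apply/existsP; exists (in_tuple s').
rewrite [tval _]/= ps' us' eqxx !andTb; apply/allP=> u us; apply: (allP alls).
have : u \in x :: s.
  move: (mem_belast us); rewrite !inE => /orP[->//|/subs' ->].
  by rewrite orbT.
rewrite lastI mem_rcons inE => /orP[/eqP eu|//].
by move: uc; rewrite rcons_uniq -l'E lE -eu us.
Qed.

Lemma nbhd_mono x C r1 r2 :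
  (r1 <= r2)%N -> nbhd F x r1 C \subset nbhd F x r2 C.
Proof.
move=> le12; apply/subsetP=> y; rewrite !inE => /existsP[k /existsP[s sP]].
have ltk : (k < r2.+1)%N by rewrite ltnS (leq_trans _ le12) // -ltnS.
by apply/existsP; exists (Ordinal ltk); apply/existsP; exists s.
Qed.

(** Dropping simplicity lets paths be cut and concatenated freely. *)
Lemma nbhdP x r C y :
  reflect (exists s, [/\ path (adj F) x s, (size s <= r)%N, last x s = y
    & all (fun u => u \notin C) (belast x s)]) (y \in nbhd F x r C).
Proof.
apply: (iffP idP) => [|[s [ps szs <- alls]]].
  rewrite inE => /existsP[k /existsP[t /and4P[pt _ /eqP lt bt]]].
  by exists t; rewrite size_tuple -ltnS.
have [k /andP[lek _]] := nbhd_size ps alls.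
by apply/subsetP/nbhd_mono/(leq_trans lek).
Qed.

Lemma nbhd_path x C s :
    path (adj F) x s -> all (fun u => u \notin C) (belast x s) ->
  last x s \in nbhd F x #|A|.-1 C.
Proof.
move=> ps alls; have [k /andP[_ ltk]] := nbhd_size ps alls.
by apply/subsetP/nbhd_mono; rewrite -ltnS (ltn_predK ltk).
Qed.

Lemma nbhd_adj x h u C :
    h \in nbhd F x #|A|.-1 C -> h \notin C -> adj F h u ->
  u \in nbhd F x #|A|.-1 C.
Proof.
case/nbhdP=> s [ps _ lasts alls] hC hu.
rewrite -(last_rcons x s u) nbhd_path ?rcons_path ?ps ?lasts //.
by rewrite belast_rcons lastI all_rcons lasts hC.
Qed.

Lemma nbhd0 x C : nbhd F x 0 C = [set x].
Proof.
apply/setP=> y; rewrite in_set1; apply/nbhdP/eqP => [[s [_ /[!leqn0]]]|->].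
  by move/nilP=> -> /= ->.
by exists [::].
Qed.

Lemma first_entry x Y s :
    path (adj F) x s -> x \notin Y -> last x s \in Y ->
  exists s1 w s2, s = rcons s1 w ++ s2 /\ w \in reach F Y #|A|.-1 x.
Proof.
move=> ps xY lastY.
have hasY : has [in Y] s.
  apply/hasP; exists (last x s) => //; case: s lastY {ps} => [/= xY'|u s _].
    by rewrite xY' in xY.
  by rewrite /= mem_last.
case: (split_find hasY) ps => w s1 s2 wY s1Y.
rewrite cat_path => /andP[ps1 _]; exists s1, w, s2; split=> //.
rewrite in_setI (_ : w \in Y) // andbT.
by rewrite -(last_rcons x s1 w) nbhd_path // belast_rcons /= xY all_predC.
Qed.

(* Every path from x into C \subset Y enters Y first at some w; from there it
   can be replaced by the path starting at y, which is adjacent to w. *)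
Lemma reach_clique x y C Y r :
    antimonotonic F -> C \subset Y -> x \notin Y -> y \notin C ->
    y \in reach F Y #|A|.-1 x -> reach F Y #|A|.-1 x \in F ->
  reach F C r x \subset reach F C r y.
Proof.
move=> antiF sCY xY yC yW WF; apply/subsetP=> c.
rewrite !in_setI => /andP[/nbhdP[s [ps szs lastc alls]] cC]; rewrite cC andbT.
have lastY : last x s \in Y by rewrite lastc (subsetP sCY).
have [s1 [w [s2 [sE wW]]]] := first_entry ps xY lastY.
move: ps szs lastc alls; rewrite {}sE.
rewrite cat_path last_cat last_rcons size_cat size_rcons.
move=> /andP[_ ps2] szs lastc.
rewrite belast_cat last_rcons all_cat => /andP[_ alls2].
apply/nbhdP; have [->|neqyw] := eqVneq y w.
  by exists s2; split=> //; apply: leq_trans szs; rewrite leq_addl.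
exists (w :: s2); rewrite /= yC; split=> //.
  rewrite ps2 /adj neqyw andbT; apply: (antiF _ _ WF).
  by rewrite subUset !sub1set yW.
by apply: leq_trans szs; rewrite addSn ltnS leq_addl.
Qed.

(** Rank entries are the increments of the size of [reach]; index [n] belongs to the step from
    radius [n] to [n.+1]. *)
Lemma card_reachS x C n (ltn : (n < #|A|.-1)%N) :
  #|reach F C n.+1 x| = (tnth (rank F x C) (Ordinal ltn) + #|reach F C n x|)%N.
Proof.
rewrite -(cardsID (nbhd F x n C) (reach F C n.+1 x)) addnC tnth_mktuple.
congr (_ + _)%N; first by rewrite /reach setIC setIDA setIC.
by rewrite /reach setIAC (setIidPr (nbhd_mono _ _ (leqnSn n))).
Qed.

(** By inclusion, the first entry at which the ranks differ would be larger for [y], against the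
    bound; with equal sizes the inclusions are equalities. *)
Lemma reach_rank_eq x y C :
    x \notin C -> y \notin C ->
    (forall n, reach F C n x \subset reach F C n y) ->
    (rank F y C <= rank F x C)%O ->
  forall n, (n <= #|A|.-1)%N -> reach F C n x = reach F C n y.
Proof.
(* [k] is the first index at which the ranks differ, or their length if they are equal. *)
move=> xC yC sxy /lexi_tupleP[k kP].
have eqk n : (n <= k)%N -> reach F C n x = reach F C n y.
  elim: n => [_|n IHn ltnk].
    apply/setP=> u; rewrite /reach !nbhd0 !inE.
    by apply/andP/andP => -[/eqP-> uC]; [rewrite uC in xC|rewrite uC in yC].
  have ltnA := leq_trans ltnk (ltn_ord k : k <= #|A|.-1)%N.
  apply/eqP; rewrite eqEcard sxy !card_reachS IHn ?(ltnW ltnk) // leq_add2r.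
  have [+ _] := kP (Ordinal ltnA) (ltnW ltnk).
  by rewrite leEnat.
have [ltk|lekA] := ltnP k #|A|.-1; last first.
  by move=> n len; apply/eqk/(leq_trans len).
have := kP (Ordinal ltk) (leqnn k); rewrite eqxx => /leifP.
have := subset_leq_card (sxy k.+1).
rewrite !card_reachS eqk // leq_add2r ltEnat /= => lexy.
by rewrite ltnNge lexy.
Qed.

Lemma added_closed C r Y x :
    antimonotonic F -> C \subset Y -> x \in added F C r ->
  reach F Y #|A|.-1 x \in F -> x \in Y.
Proof.
move=> antiF sCY /setIdP[xV /eqP rankx] WF; apply/negPn/negP=> xY.
have /setIdP[/setIdP[xC /exists_inP[b bC xb]] xF] := xV.
have : ~~ (reach F C r x \subset reach F Y #|A|.-1 x).
  by apply: contra xF; apply: antiF.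
case/subsetPn=> c; rewrite in_setI => /andP[cx cC] cW.
have [d cd dmin] := ex_minnP (ex_intro (fun n => c \in nbhd F x n C) r cx).
have /nbhdP[s [ps szs lastc alls]] := cd.
have lastY : last x s \in Y by rewrite lastc (subsetP sCY).
have [s1 [y [s2 [sE yW]]]] := first_entry ps xY lastY.
move: ps szs lastc alls; rewrite {}sE.
rewrite cat_path last_cat last_rcons size_cat size_rcons.
move=> /andP[_ ps2] szs lastc.
rewrite belast_cat last_rcons all_cat => /andP[_ alls2].
have ltd : (size s2 < d)%N by apply: leq_trans szs; rewrite addSn ltnS leq_addl.
(* Only the last vertex of the path may lie in [C], so [y] in [C] would be [c], which [cW]
   excludes. *)
have yC : y \notin C.
  case: s2 lastc alls2 {ps2 szs ltd} => [yc|u s2 _ /andP[] //].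
  by rewrite -yc yW in cW.
have sxy n : reach F C n x \subset reach F C n y by apply: reach_clique yW WF.
have yV : y \in violators F C r.
  rewrite inE; apply/andP; split; last first.
    by apply: contra xF => yF; apply: antiF yF (sxy r).
  rewrite inE yC; apply/exists_inP; exists b => //.
  have bW : b \in reach F Y #|A|.-1 x.
    rewrite in_setI (subsetP sCY) // andbT.
    by rewrite (@nbhd_path x Y [:: b]) //= ?xb ?xY.
  rewrite /adj; apply/andP; split; first by apply: contraNneq yC => ->.
  by apply: (antiF _ _ WF); rewrite subUset !sub1set yW.
have yx : (rank F y C <= rank F x C)%O.
  by rewrite rankx; apply: (le_bigmax_cond _ (fun u => rank F u C) yV).
(* [y] reaches [c] in fewer than [d] steps; by equality of the reached sets so does [x], against the
   minimality of [d]. The bound [k < #|A|] keeps the radius within the range of the ranks. *)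
have [k /andP[lek ltk]] := nbhd_size ps2 alls2.
rewrite lastc => ck.
have : c \in reach F C k x.
  rewrite (reach_rank_eq xC yC sxy yx) ?in_setI ?ck //.
  by rewrite -ltnS (ltn_predK ltk).
rewrite in_setI => /andP[/dmin led _].
by move: (leq_trans ltd (leq_trans led lek)); rewrite ltnn.
Qed.

End Neighbourhoods.

(** * Uniform distributions and parity: the probabilistic half *)

Section UniformImage.
Variables (R : realType) (I K : finType) (E : {set K}).
Variable g : K -> {ffun I -> bool}.

(** The law of [g k] for [k] uniform on [E]; [g] need not be injective, hence the sum over [k]. *)
Definition uniform_image : {ffun {ffun I -> bool} -> R} :=
  [ffun z => (\sum_(k in E) (g k == z)%:R) / #|E|%:R].

Lemma expectation_uniform_image f :
  expectation uniform_image f = (\sum_(k in E) f (g k)) / #|E|%:R.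
Proof.
transitivity ((\sum_z \sum_(k in E) (g k == z)%:R * f z) / #|E|%:R).
  rewrite mulr_suml; apply: eq_bigr => z _.
  by rewrite ffunE mulrAC; congr (_ / _); rewrite mulr_suml.
rewrite exchange_big /=; congr (_ / _); apply: eq_bigr => k _.
rewrite (bigD1 (g k)) //= eqxx mul1r big1 ?addr0 // => z neqz.
by rewrite eq_sym (negPf neqz) mul0r.
Qed.

Lemma uniform_image_distr : E != set0 -> is_distr uniform_image.
Proof.
move=> E0; split=> [z|].
  by rewrite ffunE divr_ge0 ?ler0n ?sumr_ge0 // => k _; rewrite ler0n.
have := expectation_uniform_image (fun=> 1).
rewrite /expectation; under eq_bigr do rewrite mulr1.
by move=> ->; rewrite sumr_const divff // pnatr_eq0 -lt0n card_gt0.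
Qed.

Lemma uniform_image_support z :
  uniform_image z != 0 -> exists2 k, k \in E & z = g k.
Proof.
have [/exists_inP[k kE /eqP ->]|] := boolP [exists k in E, z == g k].
  by exists k.
rewrite negb_exists_in => /forall_inP nz.
rewrite ffunE big1 ?mul0r ?eqxx // => k kE.
by rewrite eq_sym (negPf (nz k kE)).
Qed.
End UniformImage.

Lemma SfunU (R : realType) (I : finType) (U V : {set I}) z :
  Sfun R (U :|: V) z = Sfun R U z * Sfun R V z.
Proof.
rewrite /Sfun -natrM mulnb; congr (nat_of_bool _)%:R.
apply/forall_inP/andP => [UVz|[/forall_inP Uz /forall_inP Vz] i].
  by split; apply/forall_inP => i iU; apply: UVz; rewrite inE iU ?orbT.
by rewrite inE => /orP[/Uz|/Vz].
Qed.

Lemma Sfun1 (R : realType) (I : finType) (a : I) z :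
  Sfun R [set a] z = (z a)%:R.
Proof.
congr (nat_of_bool _)%:R; apply/forall_inP/idP => [->//|za i].
  by rewrite inE.
by rewrite inE => /eqP->.
Qed.

(** The difference of the two expectations is a sum of nonnegative terms [p z * (z a * (1 - z b))],
    so each of them vanishes. *)
Lemma support_implies (R : realType) (I : finType)
    (p : {ffun {ffun I -> bool} -> R}) (a b : I) z :
    is_distr p ->
    expectation p (Sfun R [set a]) = expectation p (Sfun R [set a; b]) ->
  p z != 0 -> z a -> z b.
Proof.
move=> [p0 _] /eqP; rewrite -subr_eq0 -sumrB psumr_eq0 => [|u _]; last first.
  rewrite SfunU !Sfun1 -mulrBr mulr_ge0 // -natrM mulnb subr_ge0 ler_nat.
  by case: (u a) (u b) => -[].
move=> /allP /(_ z (mem_index_enum _)) /= /[swap] pz.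
rewrite -mulrBr mulf_eq0 (negPf pz) SfunU !Sfun1 /=.
by case: (z a) (z b) => -[] //; rewrite mulr0 subr0 oner_eq0.
Qed.

(** Toggling [w] is a parity-reversing involution on the subsets of [W], and it leaves [f]
    unchanged. *)
Lemma sum_toggle (R : realType) (A : finType) (W : {set A}) (w : A)
    (b : bool) (f : {set A} -> R) :
    w \in W -> (forall T, f (w |: T) = f (T :\ w)) ->
  \sum_(T in [set T : {set A} | T \subset W & odd #|T| == b]) f T =
  \sum_(T in [set T : {set A} | T \subset W & odd #|T| == ~~ b]) f T.
Proof.
move=> wW fw; pose h (T : {set A}) := if w \in T then T :\ w else w |: T.
have hK : involutive h.
  move=> T; rewrite /h; have [wT|wT] := boolP (w \in T).
    by rewrite !inE eqxx /= setD1K.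
  by rewrite !inE eqxx /= setU1K.
rewrite (reindex_inj (inv_inj hK)); apply: eq_big => T.
  rewrite !inE /h; have [wT|wT] := boolP (w \in T).
    rewrite -{3 4}(setD1K wT) cardsU1 setD11 subUset sub1set wW /=.
    by case: odd; case: (b).
  rewrite cardsU1 wT subUset sub1set wW /=.
  by case: odd; case: (b).
move=> _; rewrite /h; have [wT|wT] := boolP (w \in T).
  by rewrite -fw (setUidPr _) ?sub1set.
rewrite fw; congr f; apply/setP => i; rewrite !inE.
by case: eqP => // ->; rewrite (negPf wT).
Qed.

(* Otherwise let N be the set of items reachable from x, W = N :&: Y, p uniform
   on the subsets of W with the parity of #|W|, where all items of N become 1
   exactly when W is full, and q uniform on the subsets of W of the other
   parity. Toggling an item of W :\: U shows that p and q agree on every U in F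
   with U \subset Y. The frequencies of p on edges force an item of N :\: Y
   equal to 1 to make its neighbours equal to 1, so x = 1, which has positive
   probability, makes all of W equal to 1; q forbids this. *)
Lemma safe_reach (R : realType) (A : finType) (F : {set {set A}})
    (Y : {set A}) (x : A) :
    antimonotonic F -> [set x] \in F -> x \notin Y -> safe R F Y ->
  reach F Y #|A|.-1 x \in F.
Proof.
move=> antiF xF xY safeY; apply/negPn/negP.
set W := reach F Y _ x => WF; set N := nbhd F x #|A|.-1 Y.
have sWY : W \subset Y by exact: subsetIr.
have xN : x \in N by apply/nbhdP; exists [::].
pose E b := [set T : {set A} | T \subset W & odd #|T| == b].
pose b := odd #|W|.
pose zA (T : {set A}) := [ffun a : A => (a \in T) || (T == W) && (a \in N)].
pose zY (T : {set A}) := [ffun i : items Y => val i \in T].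
pose p := uniform_image R (E b) zA; pose q := uniform_image R (E (~~ b)) zY.
pose theta U := expectation p (Sfun R U).
have EW : W \in E b by rewrite inE subxx eqxx.
have toggle U : U \in F ->
    \sum_(T in E b) (U \subset T)%:R =
    \sum_(T in E (~~ b)) (U \subset T)%:R :> R.
  move=> UF; have /subsetPn[w wW wU] : ~~ (W \subset U).
    by apply: contra WF; apply: antiF UF.
  apply: (sum_toggle _ wW) => T; congr (nat_of_bool _)%:R.
  apply/subsetP/subsetP=> sUT i iU; move: (sUT i iU) wU; rewrite !inE.
    by case: eqP => //= <-; rewrite iU.
  by move=> /andP[_ ->]; rewrite orbT.
(* The empty itemset counts the subsets of each parity. *)
have cardE : #|E b|%:R = #|E (~~ b)|%:R :> R.
  have sum1 c : \sum_(T in E c) (set0 \subset T)%:R = #|E c|%:R :> R.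
    by rewrite -sumr_const; apply: eq_bigr => T _; rewrite sub0set.
  by rewrite -!sum1 toggle //; apply: antiF xF (sub0set _).
have E0 : #|E b|%:R != 0 :> R.
  by rewrite pnatr_eq0 -lt0n card_gt0; apply/set0Pn; exists W.
have pD : is_distr p.
  by apply: uniform_image_distr; apply/set0Pn; exists W.
have qD : is_distr q.
  by apply: uniform_image_distr; rewrite -card_gt0 lt0n -(pnatr_eq0 R) -cardE.
have thetaF : frequencies F theta by exists p.
have qF : satisfies_in F theta q.
  move=> U UF sUY; rewrite /theta !expectation_uniform_image cardE.
  congr (_ / _); transitivity (\sum_(T in E (~~ b)) (U \subset T)%:R : R).
    apply: eq_bigr => T _; congr (nat_of_bool _)%:R.
    apply/forall_inP/subsetP => [UT i iU|UT i].
      have iY := subsetP sUY i iU.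
      by have := UT (Sub i iY); rewrite !inE ffunE; apply.
    by rewrite inE ffunE; apply: UT.
  (* Filling [N] when [T] is [W] adds no item of [Y], since [N :&: Y] is [W]. *)
  rewrite -toggle //; apply: eq_bigr => T /setIdP[sTW _].
  congr (nat_of_bool _)%:R; apply/subsetP/forall_inP => [UT i iU|UT i iU].
    by rewrite ffunE UT.
  have := UT i iU; rewrite ffunE => /orP[//|/andP[/eqP-> iN]].
  by rewrite in_setI iN (subsetP sUY).
have [p' [p'D p'q p'F]] := safeY theta thetaF q qD qF.
(* Under [p], an item [h] of [N] outside [Y] is 1 only when [T] is [W]; then all of [N] is 1,
   including [u]. Hence [theta] agrees on [[set h]] and [[set h; u]]. *)
have edge z h u : p' z != 0 -> h \in N -> h \notin Y -> adj F h u -> z h -> z u.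
  move=> p'z hN hY hu; have /andP[_ huF] := hu.
  apply: (support_implies p'D _ p'z); rewrite !p'F //; last first.
    by apply: antiF huF _; rewrite sub1set set21.
  rewrite /theta !expectation_uniform_image; congr (_ / _).
  apply: eq_bigr => T /setIdP[sTW _]; rewrite SfunU !Sfun1.
  have [zh|_] := boolP (zA T h); last by rewrite mul0r.
  suff -> : zA T u by rewrite mulr1.
  move: zh; rewrite !ffunE => /orP[hT|/andP[-> _]].
    by rewrite (subsetP sWY) ?(subsetP sTW) in hY.
  by rewrite (nbhd_adj hN) ?orbT.
have [z p'z zx] : exists2 z, p' z != 0 & z x.
  have : expectation p' (Sfun R [set x]) != 0.
    rewrite p'F // /theta expectation_uniform_image mulf_neq0 ?invr_eq0 //.
    rewrite psumr_neq0 => [|T _]; last by rewrite Sfun1.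
    apply/hasP; exists W; rewrite ?mem_index_enum // EW Sfun1 ffunE eqxx xN.
    by rewrite orbT ltr01.
  rewrite psumr_neq0 => [|z _]; last by rewrite mulr_ge0 ?Sfun1 //; case: p'D.
  case/hasP=> z _; rewrite Sfun1 => /lt0r_neq0; rewrite mulf_eq0 negb_or.
  by case/andP=> p'z; case: (boolP (z x)) => [zx _|_]; [exists z|rewrite eqxx].
have zN a : a \in N -> z a.
  case/nbhdP=> s [ps _ <- alls]; elim/last_ind: s ps alls => // s u IHs.
  rewrite rcons_path last_rcons belast_rcons lastI all_rcons.
  move=> /andP[ps su] /andP[sY alls].
  exact: (edge z _ _ p'z (nbhd_path ps alls) sY su (IHs ps alls)).
(* The restriction of [z] is some [zY T] with [T] in [E (~~ b)]; as [z] is 1 on [W], this [T] is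
   [W], which has the wrong parity. *)
have /uniform_image_support[T /setIdP[sTW /eqP oddT] zT] :
    q (restrict Y z) != 0.
  rewrite -p'q ffunE psumr_neq0 => [|u _]; last by case: p'D.
  apply/hasP; exists z; rewrite ?mem_index_enum // eqxx /= lt0r p'z /=.
  by case: p'D => p'0 _; apply: p'0.
suff eTW : T = W by move: oddT; rewrite eTW -/b; case: (b).
apply/eqP; rewrite eqEsubset sTW; apply/subsetP=> w /setIP[wN wY].
have /ffunP/(_ (Sub w wY)) := zT.
by rewrite !ffunE /= zN.
Qed.

Theorem theorem6 (R : realType) (A : finType) (F : {set {set A}})
    (antiF : antimonotonic F) (B C : {set A}) (r : nat)
    (runC : outer F B C) (violC : violation_found F C r) :
  forall Y : {set A}, safe R F Y -> C \subset Y -> added F C r \subset Y.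
Proof.
move=> Y safeY sCY; apply/subsetP=> x xZ; apply/negPn/negP=> xY.
(* A violator has an edge, so its singleton lies in [F], as [safe_reach] requires. *)
have /setIdP[/setIdP[/setIdP[_ /exists_inP[y _ /andP[_ xyF]]] _] _] := xZ.
have xF : [set x] \in F by apply: antiF xyF _; rewrite sub1set set21.
case/negP: (xY).
exact: added_closed antiF sCY xZ (safe_reach antiF xF xY safeY).
Qed.
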